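(* Let $\mathcal G=(V,E)$ be a finite regular graph with $n=|V|$ vertices, and $T$ a nonempty finite set of tiles on $\mathcal G$, all of the same size $\delta$ and with $t_v\in\{0,1\}$ for all $t\in T$, $v\in V$. Let $w:T\to\mathbb R_{>0}$ be a weight function, and suppose that $T$ and $w$ are invariant under a group of automorphisms of $\mathcal G$ acting transitively on $V$. Consider constant multiplicities $N_v\equiv N$, corresponding to $\vec\alpha=(\delta/n)_{v\in V}$, and let $\sigma$ be the exponential growth rate as a function of the multiplicity vector. Let $\Delta=DCD^*$ be the tiling laplacian for the critical weights at $\vec\alpha$. Then the second-order term of $\sigma$ at $\vec\alpha$ in a direction $d\vec\alpha\in\mathrm{Im}(D)$ with $\sum_vd\alpha_v=0$ is $$d^2\sigma=-\frac12\,d\vec\alpha^{\,t}\,\Delta^{-1}\,d\vec\alpha ;$$ that is, $\sigma(\vec\alpha+d\vec\alpha)-\sigma(\vec\alpha)=-\frac12\,d\vec\alpha^{\,t}\Delta^{-1}d\vec\alpha+o(|d\vec\alpha|^2)$ as $d\vec\alpha\to0$ (the first-order term being zero).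
   Context: A tile $t$ is a multiset of vertices, with $t_v$ the multiplicity of $v$ in $t$ (here $0$ or $1$); its size is $\sum_vt_v$. The tiling polynomial is $P(x)=\sum_{t\in T}w_t\prod_vx_v^{t_v}$ (since $t_v\in\{0,1\}$). $D:\mathbb R^T\to\mathbb R^V$ is the incidence map $D(e_t)=\sum_vt_ve_v$, $D^*$ its transpose, and $\mathcal M_{\mathbb R}=D((\mathbb R_{>0})^T)$. For $\vec\beta\in\mathcal M_{\mathbb R}$ with $\sum_v\beta_v=\delta$, the exponential growth rate is $$\sigma(\vec\beta)=\log P(\mathrm x)-\sum_v\beta_v\log\mathrm x_v,$$ where $\mathrm x\in\mathbb R_{>0}^V$ is any positive solution of $x_v\,\partial_{x_v}P/P=\beta_v$ $(v\in V)$ (the value does not depend on the choice; it is the limit of $\frac1K\log\big(\frac{K!}{\prod_vN_v!}Z(w,\mathbf N)\big)$ for the multinomial tiling partition function $Z(w,\mathbf N)$ with $K$ tiles as $N_v/K\to\beta_v$). Under the symmetry hypotheses the solution at $\vec\alpha=(\delta/n)_v$ can be taken constant, $\mathrm x_v\equiv x$, normalized so that $P=1$; the critical weights are $w_tx^\delta$, and $C$ is the diagonal matrix with these entries. $\Delta=DCD^*$ is invertible on $\mathrm{Im}(D)$ (and zero on $\ker D^*$); $\Delta^{-1}$ denotes its inverse on $\mathrm{Im}(D)$. *)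

(* Defs.v *)
From mathcomp Require Export all_boot all_order all_algebra all_fingroup finmap.
From mathcomp Require Export all_classical all_reals all_analysis.
From mathcomp Require Import ring lra.

Set Implicit Arguments.
Unset Strict Implicit.
Unset Printing Implicit Defensive.

Export Order.TTheory GRing.Theory Num.Theory.

Local Open Scope classical_set_scope.
Local Open Scope ring_scope.

Definition simple_graph (V : finType) (e : rel V) : Prop :=
  symmetric e /\ irreflexive e.

Definition regular_graph (V : finType) (e : rel V) : Prop :=
  exists k : nat, forall v : V, #|e v| = k.

Definition graph_automorphism (V : finType) (e : rel V) (g : {perm V}) : Prop :=
  forall u v : V, e (g u) (g v) = e u v.

Notation tile V := {ffun V -> nat}.

Definition tile_size (V : finType) (t : tile V) : nat := (\sum_(v : V) t v)%N.

(* Image of a tile under a relabelling of the vertices: g v has in the image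
   the multiplicity that v has in t. *)
Definition tile_image (V : finType) (g : {perm V}) (t : tile V) : tile V :=
  [ffun v => t ((g^-1)%g v)].

Definition invariant_tiles (R : realType) (V : finType) (T : {fset tile V})
    (w : T -> R) (g : {perm V}) : Prop :=
  forall t : T, exists2 s : T, val s = tile_image g (val t) & w s = w t.

Definition tiling_poly (R : realType) (V : finType) (T : {fset tile V})
    (w : T -> R) (x : V -> R) : R :=
  \sum_(t : T) w t * \prod_(v : V) x v ^+ val t v.

Definition tiling_poly_partial (R : realType) (V : finType) (T : {fset tile V})
    (w : T -> R) (v : V) (x : V -> R) : R :=
  derive1 (fun s : R => tiling_poly w (dfwith x v s)) (x v).

Definition critical_solution (R : realType) (V : finType) (T : {fset tile V})
    (w : T -> R) (beta x : V -> R) : Prop :=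
  forall v : V, 0 < x v /\
    x v * tiling_poly_partial w v x / tiling_poly w x = beta v.

(* The solution used is picked by choice; the value does not depend on it
   (growth_rateE). It is meaningful only for multiplicity vectors at which a
   positive solution exists, i.e. for beta in D ((R_{>0})^T) with
   \sum_v beta v = delta. *)
Definition growth_rate (R : realType) (V : finType) (T : {fset tile V})
    (w : T -> R) (beta : V -> R) : R :=
  let x := xget (fun=> 1) [set x : V -> R | critical_solution w beta x] in
  ln (tiling_poly w x) - \sum_(v : V) beta v * ln (x v).

Lemma tiling_poly_gt0 (R : realType) (V : finType) (T : {fset tile V})
    (w : T -> R) (x : V -> R) :
  T != fset0 -> (forall t, 0 < w t) -> (forall v, 0 < x v) ->
  0 < tiling_poly w x.
Proof.
case/fset0Pn => t0 t0T w0 x0.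
have mono t : 0 < w t * \prod_v x v ^+ val t v.
  by rewrite mulr_gt0// prodr_gt0// => v _; rewrite exprn_gt0.
rewrite /tiling_poly (bigD1 [` t0T]%fset)//= ltr_wpDr//.
  by apply: sumr_ge0 => t _; exact: ltW.
Qed.

Lemma tiling_poly_partialE (R : realType) (V : finType) (T : {fset tile V})
    (w : T -> R) (v : V) (x : V -> R) :
  x v * tiling_poly_partial w v x =
  \sum_(t : T) (val t v)%:R * (w t * \prod_(u : V) x u ^+ val t u).
Proof.
pose c t := w t * \prod_(u | u != v) x u ^+ val t u.
pose p : {poly R} := \sum_(t : T) (c t)%:P * 'X^(val t v).
have -> : tiling_poly_partial w v x = p^`().[x v].
  rewrite /tiling_poly_partial; have -> : (fun s : R => tiling_poly w (dfwith x v s)) = horner p.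
    apply/funext => s; rewrite /tiling_poly /p horner_sum.
    apply: eq_bigr => t _; rewrite hornerM hornerC hornerXn (bigD1 v)//= dfwithin.
    rewrite mulrCA mulrC /c; congr (_ * _ * _).
    by apply: eq_bigr => u uv; rewrite dfwithout// eq_sym.
  by rewrite derivE.
rewrite /p (big_morph _ (@derivD R) (@deriv0 R)) horner_sum mulr_sumr; apply: eq_bigr => t _.
rewrite derivM derivC mul0r add0r derivXn hornerM hornerC hornerMn hornerXn.
rewrite [in RHS](bigD1 v)//= /c.
case: (val t v) => [|k] /=; first by rewrite !(mulr0n, mulr0, mul0r).
by rewrite exprS -mulr_natl; ring.
Qed.

Lemma growth_value_le (R : realType) (V : finType) (T : {fset tile V})
    (w : T -> R) (beta x y : V -> R) :
  T != fset0 -> (forall t, 0 < w t) -> critical_solution w beta x ->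
  (forall v, 0 < y v) ->
  ln (tiling_poly w x) - \sum_(v : V) beta v * ln (x v) <=
  ln (tiling_poly w y) - \sum_(v : V) beta v * ln (y v).
Proof.
move=> T0 w0 xcrit y0; have x0 v : 0 < x v by case: (xcrit v).
have Px := tiling_poly_gt0 T0 w0 x0; have Py := tiling_poly_gt0 T0 w0 y0.
set X := tiling_poly w x in Px *; set Y := tiling_poly w y in Py *.
pose m (z : V -> R) (t : T) := \prod_(v : V) z v ^+ val t v.
have m0 z t : (forall v, 0 < z v) -> 0 < m z t.
  by move=> z0; rewrite prodr_gt0// => v _; rewrite exprn_gt0.
have lnm z t : (forall v, 0 < z v) ->
    ln (m z t) = \sum_v (val t v)%:R * ln (z v).
  move=> z0; rewrite /m.
  suff [_ ->] : 0 < \prod_v z v ^+ val t v /\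
     ln (\prod_v z v ^+ val t v) = \sum_v (val t v)%:R * ln (z v) by [].
  elim/big_ind2 : _ => [|a b c d [a0 <-] [c0 <-]|v _].
  - by rewrite ln1.
  - by rewrite mulr_gt0// lnM// ?posrE.
  - by rewrite exprn_gt0// lnXn// mulr_natl.
pose p t := w t * m x t / X.
have p0 t : 0 <= p t by rewrite ltW// divr_gt0// mulr_gt0// m0.
have p1 : \sum_t p t = 1 by rewrite -mulr_suml divff// gt_eqF.
pose r t := m y t / m x t * (X / Y).
have r0 t : 0 < r t by rewrite mulr_gt0// divr_gt0// m0.
have pr : \sum_t p t * r t = 1.
  have <- : (\sum_t w t * m y t) / Y = 1 by rewrite divff// gt_eqF.
  rewrite mulr_suml.
  apply: eq_bigr => t _; rewrite /p /r; field.
  by rewrite !gt_eqF// m0.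
have lnr t : ln (r t) = \sum_v (val t v)%:R * (ln (y v) - ln (x v)) +
    (ln X - ln Y).
  rewrite lnM ?posrE ?divr_gt0 ?m0// !ln_div ?posrE ?m0// !lnm//.
  by congr (_ + _); rewrite -sumrB; apply: eq_bigr => v _; rewrite mulrBr.
have le0 : \sum_t p t * ln (r t) <= 0.
  have s0 : \sum_t p t * (r t - 1) = 0.
    under eq_bigr do rewrite mulrBr mulr1.
    by rewrite sumrB pr p1 subrr.
  rewrite -[leRHS]s0; apply: ler_sum => t _; rewrite ler_wpM2l//.
  by rewrite -[in ln _](subrKC 1 (r t)) le_ln1Dx// ltrBrDl subrr.
have betaE v : \sum_t p t * (val t v)%:R = beta v.
  case: (xcrit v) => _ <-; rewrite tiling_poly_partialE mulr_suml.
  by apply: eq_bigr => t _; rewrite /p -/X -/(m x t); ring.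
move: le0; under eq_bigr do rewrite lnr mulrDr mulr_sumr.
rewrite big_split/= -mulr_suml p1 mul1r exchange_big/=.
under eq_bigr => v _.
  under eq_bigr do rewrite mulrA.
  rewrite -mulr_suml betaE mulrBr; over.
rewrite sumrB; lra.
Qed.

Lemma growth_rateE (R : realType) (V : finType) (T : {fset tile V})
    (w : T -> R) (beta x : V -> R) :
  T != fset0 -> (forall t, 0 < w t) -> critical_solution w beta x ->
  growth_rate w beta = ln (tiling_poly w x) - \sum_(v : V) beta v * ln (x v).
Proof.
move=> T0 w0 xc; rewrite /growth_rate/=.
have zc : critical_solution w beta
    (xget (fun=> 1) [set x : V -> R | critical_solution w beta x]).
  by apply: (@xgetPex _ _ [set x : V -> R | critical_solution w beta x]); exists x.
by apply/eqP; rewrite eq_le; apply/andP; split; apply: growth_value_le => // v;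
  [case: (xc v)|case: (zc v)].
Qed.

Definition incidence (R : realType) (V : finType) (T : {fset tile V})
    (f : T -> R) : V -> R :=
  fun v => \sum_(t : T) (val t v)%:R * f t.

Definition incidence_adj (R : realType) (V : finType) (T : {fset tile V})
    (h : V -> R) : T -> R :=
  fun t => \sum_(v : V) (val t v)%:R * h v.

(* Delta = D C D^*, with C the diagonal matrix with entries c. *)
Definition tiling_laplacian (R : realType) (V : finType) (T : {fset tile V})
    (c : T -> R) (h : V -> R) : V -> R :=
  incidence (fun t : T => c t * incidence_adj h t).

(* Inverse of Delta on Im(D): the element of Im(D) that Delta sends to u,
   which exists and is unique when c > 0 and u is in Im(D). *)
Definition tiling_laplacian_inv (R : realType) (V : finType)
    (T : {fset tile V}) (c : T -> R) (u : V -> R) : V -> R :=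
  xget (fun=> 0) [set y : V -> R | range (@incidence R V T) y /\ tiling_laplacian c y = u].

Definition uniform_mult (R : realType) (V : finType) (delta : nat) : V -> R :=
  fun=> delta%:R / #|V|%:R.

(* The common value of the coordinates of the constant critical solution at
   alpha, normalized by P = 1; it is unique when delta > 0. *)
Definition uniform_solution (R : realType) (V : finType) (T : {fset tile V})
    (w : T -> R) (delta : nat) : R :=
  xget 1 [set x : R | critical_solution w (@uniform_mult R V delta) (fun=> x) /\
                   tiling_poly w (fun=> x) = 1].

Definition critical_weight (R : realType) (V : finType) (T : {fset tile V})
    (w : T -> R) (delta : nat) : T -> R :=
  fun t => w t * uniform_solution w delta ^+ delta.

(* Main.v *)
(* The growth rate is a Legendre transform. Let p be the critical weights,
   y = Delta^{-1} da and z = D^t y. The difference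
   sigma(alpha + da) - sigma(alpha) is the minimum over s in Im(D^t) of
     Psi(s) = \sum_t p_t (exp s_t - 1 - s_t - z_t s_t),
   a small perturbation of the quadratic \sum_t p_t (s_t^2 / 2 - z_t s_t), whose
   minimum, at s = z, is -1/2 \sum_t p_t z_t^2 = -1/2 da . Delta^{-1} da.
   Restricted to a small box, Psi has a minimiser; coercivity puts it in the
   interior when da is small, and stationarity there is the critical equation at
   alpha + da, so a positive solution exists. *)
Require Import Defs.
From mathcomp Require Import ring lra.

Set Implicit Arguments.
Unset Strict Implicit.
Unset Printing Implicit Defensive.

Import numFieldNormedType.Exports.

Local Open Scope classical_set_scope.
Local Open Scope ring_scope.

(** * Weighted Gram matrices and normal equations *)

Lemma submx_gram (R : realFieldType) (m n : nat) (A : 'M[R]_(m, n))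
    (d : 'rV[R]_m) :
  (forall i, 0 < d 0 i) -> (A <= A^T *m diag_mx d *m A)%MS.
Proof.
(* Y = A *m cokermx M satisfies Y^T d Y = 0, hence Y = 0 by positivity of d. *)
move=> d0; set M := _ *m A; rewrite submxE; set Y := A *m _.
have YY : Y^T *m diag_mx d *m Y = 0.
  rewrite {1}/Y trmx_mul -!mulmxA (mulmxA A^T) /Y (mulmxA _ A).
  by rewrite -/M mulmx_coker mulmx0.
move: Y YY => Y YY; apply/eqP/matrixP => i j; rewrite [RHS]mxE.
have := congr1 (fun B : 'M[R]_(_, _) => B j j) YY; rewrite mul_mx_diag !mxE.
under eq_bigr do rewrite !mxE mulrAC -expr2.
move/psumr_eq0P => /(_ _ i isT) Yij.
have /eqP : Y i j ^+ 2 * d 0 i = 0.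
  by apply: Yij => k _; rewrite mulr_ge0 ?sqr_ge0// ltW.
by rewrite mulf_eq0 sqrf_eq0 (gt_eqF (d0 i)) orbF => /eqP.
Qed.

(* Writing u = a^T f, the vector x k = \sum_l B l k * u l, linear in u, solves
   a^T c a x = u. *)
Lemma normal_equations (R : realFieldType) (I J : finType) (a : I -> J -> R)
    (c : I -> R) : (forall i, 0 < c i) ->
  exists B : J -> J -> R, forall (f : I -> R) (j : J),
    \sum_i a i j * (c i *
      \sum_k a i k * \sum_l B l k * \sum_i' a i' l * f i') =
    \sum_i a i j * f i.
Proof.
move=> c0.
pose A := \matrix_(i < #|I|, j < #|J|) a (enum_val i) (enum_val j).
pose d := \row_(i < #|I|) c (enum_val i).
have d0 i : 0 < d 0 i by rewrite mxE.
pose M := A^T *m diag_mx d *m A.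
exists (fun l k => pinvmx M (enum_rank l) (enum_rank k)) => f j.
pose u := (\row_i f (enum_val i)) *m A.
(* [u] lies in the row space of [A], which [submx_gram] places inside that of [M], so the
   pseudo-inverse solves the system exactly. *)
have uM : u *m pinvmx M *m A^T *m diag_mx d *m A = u.
  rewrite -[RHS](@mulmxKpV _ _ _ _ u M) ?/M ?mulmxA//.
  exact: submx_trans (submxMl _ _) (submx_gram _ d0).
have uE l : u 0 l = \sum_i a i (enum_val l) * f i.
  rewrite mxE (reindex _ (onW_bij _ (enum_val_bij I)))/=.
  by apply: eq_bigr => i _; rewrite !mxE mulrC.
rewrite -[j in RHS]enum_rankK -uE -uM mxE.
rewrite (reindex _ (onW_bij _ (enum_val_bij I)))/=; apply: eq_bigr => i _.
rewrite mul_mx_diag !mxE enum_rankK mulrC; congr (_ * _).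
rewrite mulrC; congr (_ * _).
rewrite (reindex _ (onW_bij _ (enum_val_bij J)))/=; apply: eq_bigr => k _.
rewrite !mxE mulrC; congr (_ * _).
rewrite (reindex _ (onW_bij _ (enum_val_bij J)))/=; apply: eq_bigr => l _.
by rewrite uE !enum_valK mulrC.
Qed.

(** * Taylor remainders of the exponential *)

Lemma norm_le_of_derive (R : realType) (f df : R -> R) (M r : R) :
  (forall x : R, is_derive x (1 : R) f (df x)) -> f 0 = 0 ->
  (forall x, `|x| <= r -> `|df x| <= M) ->
  forall x, `|x| <= r -> `|f x| <= M * `|x|.
Proof.
move=> fdf f0 dfM x xr.
have fc a b : {within `[a, b], continuous f}.
  apply/continuous_subspaceT => y.
  apply/differentiable_continuous/derivable1_diffP.
  by case: (fdf y).
have [x0|x0] := leP 0 x.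
  have [c cx E] := @MVT_segment R f df 0 x x0 (fun y _ => fdf y) (fc _ _).
  move: E; rewrite f0 !subr0 => ->; rewrite normrM ler_wpM2r// dfM//.
  move: cx; rewrite in_itv/= => /andP[c0 cx].
  by apply: le_trans xr; rewrite !ger0_norm.
have [c cx E] := @MVT_segment R f df x 0 (ltW x0) (fun y _ => fdf y) (fc _ _).
move: E; rewrite f0 !sub0r => /eqP; rewrite eqr_oppLR => /eqP ->.
rewrite normrN normrM normrN ler_wpM2r// dfM//.
move: cx; rewrite in_itv/= => /andP[xc c0].
by apply: le_trans xr; rewrite !ler0_norm ?lerN2// ltW.
Qed.

(** The mean value bound is applied twice, to [expR y - 1] and then to [expR y - 1 - y]; [expR 1]
    bounds the exponential on the unit interval. *)
Lemma expR_remainder1 (R : realType) (x : R) : `|x| <= 1 ->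
  `|expR x - 1 - x| <= expR 1 * x ^+ 2.
Proof.
move=> x1.
have e1 y : `|y| <= `|x| -> `|expR y - 1| <= expR 1 * `|x|.
  move=> yx; apply: (@le_trans _ _ (expR 1 * `|y|)); last first.
    by rewrite ler_wpM2l ?expR_ge0.
  apply: (@norm_le_of_derive R (fun y => expR y - 1) (@expR R) _ 1) => //.
  - move=> u; rewrite -[X in is_derive _ _ _ X]subr0.
    exact: is_deriveB.
  - by rewrite expR0 subrr.
  - move=> u u1; rewrite ger0_norm ?expR_ge0// ler_expR.
    exact: le_trans (ler_norm _) u1.
  - exact: le_trans yx x1.
rewrite -real_normK ?num_real// expr2 mulrA.
apply: (@norm_le_of_derive R (fun y => expR y - 1 - y)
  (fun y => expR y - 1) _ `|x|) => //.
- move=> u; rewrite -[X in is_derive _ _ _ (X - _)]subr0.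
  by do 2 apply: is_deriveB.
- by rewrite expR0 !subrr.
Qed.

(** One more integration of the previous bound. The factor [|x|] makes the error arbitrarily small
    relative to [x ^+ 2] near 0. *)
Lemma expR_remainder2 (R : realType) (x : R) : `|x| <= 1 ->
  `|expR x - 1 - x - x ^+ 2 / 2| <= expR 1 * `|x| * x ^+ 2.
Proof.
move=> x1.
rewrite -[x ^+ 2 in leRHS]real_normK ?num_real// [leRHS]mulrAC.
apply: (@norm_le_of_derive R (fun y => expR y - 1 - y - y ^+ 2 / 2)
  (fun y => expR y - 1 - y) _ `|x|) => //.
- move=> u; apply: is_derive_eq.
  by rewrite /GRing.scale/= !mulr0 add0r mulr1; field.
- by rewrite expR0 !subrr expr0n mul0r subr0.
- move=> y yx; apply: le_trans (expR_remainder1 (le_trans yx x1)) _.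
  by rewrite ler_wpM2l ?expR_ge0// -real_normK ?num_real// ler_sqr ?nnegrE.
Qed.

(** * Minimisation of a perturbed quadratic on a subspace *)

(** The subspace is given as the fixed vectors of a matrix [Q], a closed condition; its intersection
    with the box, compact by Tychonoff, is compact and contains 0. *)
Lemma separable_min_box (R : realType) (I : finType) (Q : I -> I -> R)
    (F : I -> R -> R) (r : R) : 0 <= r -> (forall i, continuous (F i)) ->
  let K := [set s : I -> R | (forall i, `|s i| <= r) /\
                             forall i, \sum_j s j * Q j i = s i] in
  exists2 s, K s & forall s', K s' -> \sum_i F i (s i) <= \sum_i F i (s' i).
Proof.
move=> r0 Fc K; pose X := prod_topology (fun _ : I => R^o : topologicalType).
have pr i : continuous (fun s : X => s i : R^o).
  exact: (@proj_continuous _ (fun _ : I => R^o : topologicalType)).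
have sumc (G : I -> X -> R) : (forall i, continuous (G i)) ->
    continuous (fun s => \sum_i G i s).
  by move=> Gc; apply: continuous_big => //; exact: add_continuous.
have Kc : compact (K : set X).
  have -> : (K : set X) = [set s : X | forall i, `[- r, r]%classic (s i)] `&`
      \bigcap_i ((fun s : X => \sum_j s j * Q j i - s i) @^-1` [set 0]).
    apply/seteqP; split => s /=.
      move=> [sr sQ]; split=> i; first by rewrite in_itv/= -ler_norml.
      by move=> _ /=; rewrite sQ subrr.
    move=> [sr sQ]; split=> i; first by move: (sr i); rewrite in_itv/= -ler_norml.
    by apply/eqP; rewrite -subr_eq0; apply/eqP; exact: sQ.
  apply: compact_closedI.
    by apply: (@tychonoff _ (fun _ : I => R^o : topologicalType)
      (fun=> `[- r, r]%classic)) => i; exact: segment_compact.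
  apply: closed_bigI => i _; apply: preimage_closed => //.
  have Qc : continuous (fun s : X => \sum_j s j * Q j i : R^o).
    by apply: sumc => j u; apply: continuousM; [exact: pr|exact: cst_continuous].
  by move=> s _; exact: continuousB (Qc s) (pr i s).
have K0 : (K : set X) !=set0.
  exists (fun=> 0); split=> i; rewrite ?normr0//.
  by rewrite big1// => j _; rewrite mul0r.
have Sc : {within (K : set X), continuous (fun s : X => \sum_i F i (s i))}.
  apply: continuous_subspaceT; apply: sumc => i s.
  exact: (continuous_comp (pr i s) (Fc i _)).
have [s /set_mem sK smin] := compact_EVT_min K0 Kc Sc.
by exists s => // s' /mem_set/smin.
Qed.

Lemma first_order_eq0 (R : realFieldType) (A B tau0 : R) : 0 < tau0 -> 0 <= B ->
  (forall tau : R, `|tau| <= tau0 -> 0 <= tau * A + tau ^+ 2 * B) -> A = 0.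
Proof.
move=> t0 B0 AB.
have A0 := normr_ge0 A.
have b0 : 0 <= tau0 * B by rewrite mulr_ge0// ltW.
(* The test value is [tau = - t * A]: the first divisor keeps it within [tau0], the second gives
   [t * B < 1]. *)
pose t := tau0 / (1 + `|A|) / (1 + tau0 * B).
have tp : 0 < t by rewrite !divr_gt0// ltr_pwDl.
have te : t * (1 + `|A|) * (1 + tau0 * B) = tau0.
  by rewrite /t; field; rewrite !gt_eqF// ltr_pwDl.
have ta := mulr_ge0 (ltW tp) A0; have tb := mulr_ge0 (ltW tp) b0.
have tab := mulr_ge0 ta b0.
have tA : `|- t * A| <= tau0 by rewrite normrM normrN (gtr0_norm tp); lra.
have tB : t * B < 1 by rewrite -(ltr_pM2l t0); nra.
have := AB _ tA; have -> : - t * A * A + (- t * A) ^+ 2 * B =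
  - (t * (1 - t * B) * A ^+ 2) by ring.
rewrite oppr_ge0 pmulr_rle0 => [A2|]; last by rewrite (mulr_gt0 tp) ?subr_gt0.
by apply/eqP; rewrite -sqrf_eq0 eq_le A2 sqr_ge0.
Qed.

(** Converts bounds on the weighted energy into coordinatewise bounds, hence into membership in a
    box. *)
Lemma sqr_le_weighted_sum (R : realFieldType) (I : finType) (p s : I -> R) (i : I) :
  (forall i, 0 < p i) ->
  s i ^+ 2 <= (\sum_j (p j)^-1) * \sum_j p j * s j ^+ 2.
Proof.
move=> p0; have -> : s i ^+ 2 = (p i)^-1 * (p i * s i ^+ 2).
  by rewrite mulKf ?gt_eqF.
have pV0 j : 0 <= (p j)^-1 by rewrite invr_ge0 ltW.
have ps0 j : 0 <= p j * s j ^+ 2 by rewrite mulr_ge0 ?sqr_ge0// ltW.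
by apply: ler_pM => //; rewrite [leRHS](bigD1 i)//= lerDl sumr_ge0.
Qed.

(** On the box the objective lies between the quadratics with leading coefficients [1 / 2 - eps] and
    [1 / 2 + eps]. The smallness of [z] puts the minimiser in the interior of the box, so it is
    stationary along the whole subspace. *)
Lemma perturbed_exp_min (R : realType) (I : finType) (Q : I -> I -> R)
    (p z : I -> R) (r eps : R) :
  (forall i, 0 < p i) -> 0 < r -> eps <= 1 / 4 ->
  (forall x, `|x| <= r -> `|expR x - 1 - x - x ^+ 2 / 2| <= eps * x ^+ 2) ->
  (forall i, \sum_j z j * Q j i = z i) ->
  16 * (\sum_j (p j)^-1) * (\sum_j p j * z j ^+ 2) < r ^+ 2 ->
  exists s : I -> R, [/\
    forall i, \sum_j s j * Q j i = s i,
    forall d, (forall i, \sum_j d j * Q j i = d i) ->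
      \sum_i p i * (expR (s i) - 1 - z i) * d i = 0 &
    `|\sum_i p i * (expR (s i) - 1 - s i - z i * s i) +
      1 / 2 * \sum_i p i * z i ^+ 2| <= 16 * eps * \sum_i p i * z i ^+ 2].
Proof.
move=> p0 r0 eps4 expeps zQ zr.
pose F i x := p i * (expR x - 1 - x - z i * x).
have Fc i : continuous (F i).
  move=> x; apply/differentiable_continuous/derivable1_diffP.
  by apply: ex_derive.
set Z := \sum_i p i * z i ^+ 2 in zr *; set J := \sum_j (p j)^-1 in zr.
have Z0 : 0 <= Z by apply: sumr_ge0 => i _; rewrite mulr_ge0 ?sqr_ge0 ?ltW.
have J0 : 0 <= J by apply: sumr_ge0 => i _; rewrite invr_ge0 ltW.
have JZ : 0 <= J * Z by rewrite mulr_ge0.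
have [s [sr sQ] smin] := separable_min_box Q (ltW r0) Fc.
have Fge i (x : R) : `|x| <= r ->
    p i * (x ^+ 2 / 2 - eps * x ^+ 2 - z i * x) <= F i x.
  by move=> /expeps; rewrite ler_norml => /andP[h _]; rewrite ler_pM2l//; lra.
have Fle i x : `|x| <= r -> F i x <= p i * (x ^+ 2 / 2 + eps * x ^+ 2 - z i * x).
  by move=> /expeps; rewrite ler_norml => /andP[_ h]; rewrite ler_pM2l//; lra.
have s0 : \sum_i F i (s i) <= 0.
  rewrite [leRHS](_ : 0 = \sum_i F i 0); last first.
    by rewrite big1// => i _; rewrite /F expR0 mulr0 !subr0 subrr mulr0.
  apply: (smin (fun=> 0)); split=> i; first by rewrite normr0 ltW.
  by rewrite big1// => j _; rewrite mul0r.
(* Coercivity: since [eps <= 1 / 4], each term is at least [p i * (s i ^+ 2 / 8 - 2 * z i ^+ 2)], by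
   expanding [(s i - 4 * z i) ^+ 2 >= 0], while the minimum is at most the value 0 at the origin. *)
have sZ : \sum_i p i * s i ^+ 2 <= 16 * Z.
  have : 0 <= \sum_i (2 * (p i * z i ^+ 2) - p i * s i ^+ 2 / 8).
    rewrite -oppr_le0 -sumrN; apply: le_trans s0; apply: ler_sum => i _.
    apply: le_trans (Fge _ _ (sr i)).
    have -> : - (2 * (p i * z i ^+ 2) - p i * s i ^+ 2 / 8) =
      p i * (s i ^+ 2 / 8 - 2 * z i ^+ 2) by lra.
    rewrite ler_pM2l//.
    have : 0 <= (1 / 4 - eps) * s i ^+ 2 by rewrite mulr_ge0 ?subr_ge0 ?sqr_ge0.
    have : 0 <= (s i - 4 * z i) ^+ 2 by apply: sqr_ge0.
    nra.
  rewrite sumrB -mulr_sumr -mulr_suml -/Z; lra.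
have small t i : \sum_i p i * t i ^+ 2 <= 16 * Z ->
    `|t i| <= Num.sqrt (16 * (J * Z)).
  move=> tZ; rewrite -sqrtr_sqr ler_wsqrtr//.
  apply: le_trans (sqr_le_weighted_sum _ _ p0) _.
  by rewrite -/J mulrCA ler_wpM2l.
(* Both [s] and [z] have energy at most [16 * Z], so both lie in the box of radius [rho < r]. *)
set rho := Num.sqrt _ in small.
have rhor : rho < r.
  by rewrite -(gtr0_norm r0) -sqrtr_sqr ltr_sqrt ?exprn_gt0// mulrA.
exists s; split=> // [d dQ|].
- have pe i : 0 <= p i * expR (s i) by rewrite mulr_ge0 ?expR_ge0// ltW.
  pose D : R := \sum_i `|d i|.
  have D0 : 0 <= D by apply: sumr_ge0.
  have dD i : `|d i| <= D by rewrite /D (bigD1 i)//= lerDl sumr_ge0.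
  pose B := \sum_i p i * expR (s i) * (expR 1 * d i ^+ 2).
  have B0 : 0 <= B.
    apply: sumr_ge0 => i _; apply: mulr_ge0 (pe i) _.
    by rewrite mulr_ge0 ?expR_ge0 ?sqr_ge0.
  (* The bound 1 keeps [tau * d i] in the range of the remainder estimate, and [r - rho] keeps
     [s + tau * d] in the box. *)
  pose tau0 := Num.min 1 (r - rho) / (1 + D).
  have tau00 : 0 < tau0 by rewrite divr_gt0 ?lt_min ?ltr01 ?subr_gt0// ltr_pwDl.
  apply: (first_order_eq0 tau00 B0) => tau ttau.
  have taud i : `|tau * d i| <= Num.min 1 (r - rho).
    rewrite normrM.
    apply: (@le_trans _ _ (tau0 * (1 + D))).
      by rewrite ler_pM// (le_trans (dD i))// lerDr.
    by rewrite /tau0 divfK// gt_eqF// ltr_pwDl.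
  have taud1 i : `|tau * d i| <= 1.
    by apply: le_trans (taud i) _; rewrite ge_min lexx.
  have := smin (fun i => s i + tau * d i).
  rewrite -subr_ge0 -sumrB => h; apply: le_trans (h _) _.
    split=> i.
      apply: le_trans (ler_normD _ _) _.
      rewrite -lerBrDl (le_trans (taud i))// ge_min; apply/orP; right.
      by rewrite lerD2l lerN2 small.
    rewrite -[in RHS]sQ -[in RHS]dQ mulr_sumr -big_split/=.
    by apply: eq_bigr => j _; ring.
  (* Termwise, [expR (s i + tau * d i)] is expanded around [s i]; [B] collects the second-order
     remainders. *)
  rewrite mulr_sumr mulr_sumr -big_split/=; apply: ler_sum => i _.
  rewrite /F expRD.
  have := expR_remainder1 (taud1 i); rewrite ler_norml => /andP[_ h2].
  have := ler_wpM2l (pe i) h2; lra.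
- have zr' i : `|z i| <= r.
    by apply/ltW/(le_lt_trans _ rhor)/small; rewrite -/Z; lra.
  (* Upper bound: [z], the minimiser of the unperturbed quadratic, is an admissible competitor. *)
  have up : \sum_i F i (s i) <= eps * Z - 1 / 2 * Z.
    apply: le_trans (smin z _) _; first by split.
    rewrite !mulr_sumr -sumrB; apply: ler_sum => i _.
    by apply: le_trans (Fle _ _ (zr' i)) _; lra.
  (* Lower bound by completing the square; the error [eps * \sum_i p i * s i ^+ 2] is at most
     [16 * eps * Z] by [sZ]. *)
  have lo : - (1 / 2) * Z - eps * (\sum_i p i * s i ^+ 2) <= \sum_i F i (s i).
    rewrite !mulr_sumr -sumrB; apply: ler_sum => i _.
    apply: le_trans (Fge _ _ (sr i)).
    have : 0 <= p i * (s i - z i) ^+ 2 by rewrite mulr_ge0 ?sqr_ge0 ?ltW.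
    lra.
  have eps0 : 0 <= eps.
    have := expeps r; rewrite gtr0_norm// lexx => /(_ isT).
    by move/(le_trans (normr_ge0 _)); rewrite pmulr_lge0// exprn_gt0.
  have := ler_wpM2l eps0 sZ; have := mulr_ge0 eps0 Z0.
  rewrite -/(F _ _) ler_norml => eZ sZe.
  apply/andP; split; lra.
Qed.

(** * The incidence map and the inverse of the laplacian *)

Lemma quadratic_form_le (R : realFieldType) (V : finType) (B : V -> V -> R)
    (u : V -> R) :
  \sum_v u v * (\sum_l B l v * u l) <=
  (\sum_v \sum_l `|B l v|) * \sum_v u v ^+ 2.
Proof.
have uS v : u v ^+ 2 <= \sum_v u v ^+ 2.
  by rewrite [leRHS](bigD1 v)//= lerDl sumr_ge0// => i _; exact: sqr_ge0.
rewrite mulr_suml; apply: ler_sum => v _; rewrite mulr_sumr mulr_suml.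
apply: ler_sum => l _; rewrite mulrCA; apply: le_trans (ler_norm _) _.
rewrite normrM ler_wpM2l// ler_norml; have := uS v; have := uS l.
have := sqr_ge0 (u v + u l); have := sqr_ge0 (u v - u l).
by move=> *; apply/andP; split; nra.
Qed.

Lemma incidence_adjE (R : realType) (V : finType) (T : {fset tile V})
    (f : T -> R) (h : V -> R) :
  \sum_v incidence f v * h v = \sum_t f t * incidence_adj h t.
Proof.
under eq_bigr do rewrite /incidence mulr_suml.
rewrite exchange_big/=; apply: eq_bigr => t _.
by rewrite /incidence_adj mulr_sumr; apply: eq_bigr => v _; ring.
Qed.

(** Adjointness tested against the constant function 1, which D^t sends to the constant [delta]. *)
Lemma sum_incidence (R : realType) (V : finType) (T : {fset tile V})
    (delta : nat) (f : T -> R) : (forall t : T, tile_size (val t) = delta) ->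
  \sum_v incidence f v = delta%:R * \sum_t f t.
Proof.
move=> Td; under eq_bigr do rewrite -[incidence _ _]mulr1.
rewrite (incidence_adjE f (fun=> 1)) mulr_sumr; apply: eq_bigr => t _.
rewrite mulrC; congr (_ * _); rewrite /incidence_adj -(Td t) /tile_size natr_sum.
by apply: eq_bigr => v _; rewrite mulr1.
Qed.

(** [Q] sends [s] to D^t D x, where x is given linearly by the normal equations for [s]. Its values
    therefore lie in Im D^t, and it fixes every vector of Im D^t. *)
Lemma range_incidence_adjP (R : realType) (V : finType) (T : {fset tile V}) :
  exists Q : T -> T -> R, forall s : T -> R,
    range (@incidence_adj R V T) s <-> forall t, \sum_j s j * Q j t = s t.
Proof.
have [|B HB] := @normal_equations R V T (fun v t => (val t v)%:R) (fun=> 1).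
  by move=> ?; exact: ltr01.
pose g (j : T) v := \sum_(k : T) (val k v)%:R * B j k.
have gE (s : T -> R) v : \sum_j s j * g j v =
    \sum_(k : T) (val k v)%:R * \sum_l B l k * s l.
  under eq_bigr do rewrite mulr_sumr.
  rewrite exchange_big/=; apply: eq_bigr => k _; rewrite mulr_sumr.
  by apply: eq_bigr => j _; ring.
have QE (s : T -> R) (t : T) : \sum_j s j * incidence_adj (g j) t =
    incidence_adj (fun v => \sum_j s j * g j v) t.
  rewrite /incidence_adj; under eq_bigr do rewrite mulr_sumr.
  rewrite exchange_big/=; apply: eq_bigr => v _; rewrite mulr_sumr.
  by apply: eq_bigr => j _; ring.
exists (fun j t => incidence_adj (g j) t) => s; split=> [[h _ <-] t|sQ].
  by rewrite QE -[RHS]HB; apply: eq_bigr => v _; rewrite gE mul1r.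
exists (fun v => \sum_j s j * g j v) => //.
by apply/funext => t; rewrite -QE sQ.
Qed.

(** Shows that the choice defining the inverse succeeds on Im D, and bounds the inverse quadratic
    form by the Euclidean norm uniformly in [u]. *)
Lemma tiling_laplacian_invP (R : realType) (V : finType) (T : {fset tile V})
    (c : T -> R) : (forall t, 0 < c t) ->
  exists2 L : R, 0 <= L & forall u, range (@incidence R V T) u ->
    let y := tiling_laplacian_inv c u in
    [/\ range (@incidence R V T) y, tiling_laplacian c y = u &
        \sum_v u v * y v <= L * \sum_v u v ^+ 2].
Proof.
move=> c0.
have [B HB] := @normal_equations R T V (fun t v => (val t v)%:R) c c0.
have [|B' HB'] := @normal_equations R V T (fun v t => (val t v)%:R) (fun=> 1).
  by move=> ?; exact: ltr01.
exists (\sum_v \sum_l `|B l v|).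
  by apply: sumr_ge0 => v _; apply: sumr_ge0.
move=> u [f _ fu]; pose k v := \sum_l B l v * u l.
have kE : tiling_laplacian c k = u.
  by rewrite /k -fu; apply/funext => v; exact: HB.
(* The solution [k] need not lie in Im D. A second use of the normal equations gives [y0] in Im D
   with the same image under D^t, hence the same laplacian. *)
pose y0 := incidence (fun t => \sum_l B' l t * incidence_adj k l).
have y0k : incidence_adj y0 = incidence_adj k :> (T -> R).
  apply/funext => t; rewrite -[RHS]HB'.
  by apply: eq_bigr => v _; rewrite mul1r.
move=> y.
have [yD yE] : range (@incidence R V T) y /\ tiling_laplacian c y = u.
  apply: (@xgetPex _ _ [set y : V -> R | range (@incidence R V T) y /\
    tiling_laplacian c y = u]).
  exists y0; split; first by exists (fun t => \sum_l B' l t * incidence_adj k l).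
  by rewrite -kE /tiling_laplacian y0k.
split => //; apply: le_trans (quadratic_form_le _ _).
(* By symmetry of the laplacian, [u] pairs equally with [y] and with [k], and [k] is an explicit
   linear function of [u]. *)
have sym (a b : V -> R) : \sum_v tiling_laplacian c a v * b v =
    \sum_v tiling_laplacian c b v * a v.
  by rewrite !incidence_adjE; apply: eq_bigr => t _; ring.
by rewrite -[in leLHS]kE sym yE.
Qed.

(** * Critical solutions in exponential coordinates *)

Lemma tile_monomial_exp (R : realType) (V : finType) (t : tile V) (x : R)
    (h : V -> R) :
  \prod_v (x * expR (h v)) ^+ t v =
  x ^+ tile_size t * expR (\sum_v (t v)%:R * h v).
Proof.
rewrite /tile_size expR_sum -prodrXr -big_split/=.
by apply: eq_bigr => v _; rewrite exprMn expRM_natl.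
Qed.

(** At the point [x * expR (h v)] the term of [t] in the tiling polynomial is [q t], so the critical
    equation with P = 1 says that [q] has mass 1 and D q = [beta]. *)
Lemma critical_solution_exp (R : realType) (V : finType) (T : {fset tile V})
    (delta : nat) (w : T -> R) (beta h : V -> R) (x : R) :
  let q t := w t * x ^+ delta * expR (incidence_adj h t) in
  (forall t : T, tile_size (val t) = delta) -> 0 < x ->
  \sum_t q t = 1 -> incidence q = beta ->
  critical_solution w beta (fun v => x * expR (h v)) /\
  tiling_poly w (fun v => x * expR (h v)) = 1.
Proof.
move=> q Td x0 q1 qb.
have qE t : w t * \prod_v (x * expR (h v)) ^+ val t v = q t.
  by rewrite tile_monomial_exp Td mulrA.
have P1 : tiling_poly w (fun v => x * expR (h v)) = 1.
  by rewrite -q1; apply: eq_bigr => t _; exact: qE.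
split=> // v; split; first by rewrite mulr_gt0 ?expR_gt0.
rewrite P1 divr1 (tiling_poly_partialE w v (fun v => x * expR (h v))) -qb.
by apply: eq_bigr => t _; rewrite qE.
Qed.

(** As [q] has mass 1, the entries of [beta] sum to [delta], so the constant factor [x] contributes
    [delta%:R * ln x]. *)
Lemma growth_rate_exp (R : realType) (V : finType) (T : {fset tile V})
    (delta : nat) (w : T -> R) (beta h : V -> R) (x : R) :
  let q t := w t * x ^+ delta * expR (incidence_adj h t) in
  T != fset0 -> (forall t, 0 < w t) ->
  (forall t : T, tile_size (val t) = delta) -> 0 < x ->
  \sum_t q t = 1 -> incidence q = beta ->
  growth_rate w beta = - (delta%:R * ln x) - \sum_v beta v * h v.
Proof.
move=> q T0 w0 Td x0 q1 qb.
have [xc P1] := critical_solution_exp Td x0 q1 qb.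
rewrite (growth_rateE T0 w0 xc) P1 ln1 sub0r -opprD; congr (- _).
under eq_bigr do rewrite lnM ?posrE ?expR_gt0// expRK mulrDr.
rewrite big_split/= -mulr_suml; congr (_ * _ + _).
by rewrite -qb (sum_incidence _ Td) q1 mulr1.
Qed.

(** * Symmetry and the uniform solution *)

(** Relabelling by [g] is an injective, hence bijective, weight-preserving map of the finite set [T]
    to itself, so the sum can be reindexed along it. *)
Lemma incidence_weight_invariant (R : realType) (V : finType)
    (T : {fset tile V}) (w : T -> R) (g : {perm V}) (v : V) :
  invariant_tiles w g -> incidence w (g v) = incidence w v.
Proof.
move=> gw; have [F FE] := choice (fun t => let: ex_intro2 s a b := gw t in
  ex_intro (fun s => val s = tile_image g (val t) /\ w s = w t) s (conj a b)).
have Fg t u : val (F t) (g u) = val t u.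
  by have [-> _] := FE t; rewrite ffunE permK.
have Finj : injective F.
  move=> s t st; apply/val_inj/ffunP => u.
  by rewrite -(Fg s) st Fg.
rewrite /incidence (reindex_inj Finj)/=; apply: eq_bigr => t _.
by rewrite Fg; have [_ ->] := FE t.
Qed.

(** Transitivity makes D w constant on vertices, and counting total mass identifies the constant;
    scaling [x] to give P = 1 then yields a critical solution. *)
Lemma uniform_solution_spec (R : realType) (V : finType) (T : {fset tile V})
    (delta : nat) (w : T -> R) (G : {group {perm V}}) :
  (0 < delta)%N -> T != fset0 -> (forall t, 0 < w t) ->
  (forall t : T, tile_size (val t) = delta) ->
  (forall g : {perm V}, g \in G -> invariant_tiles w g) ->
  [transitive G, on [set: V]%SET | 'P] ->
  let x := uniform_solution w delta in
  [/\ 0 < x, \sum_t w t * x ^+ delta = 1 &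
      incidence (fun t => w t * x ^+ delta) = @uniform_mult R V delta].
Proof.
move=> delta0 T0 w0 Td Gw Gtr.
have constD u v : incidence w u = incidence w v.
  have [g gG ->] := atransP2 Gtr (finset.in_setT v) (finset.in_setT u).
  by rewrite [LHS](incidence_weight_invariant v (Gw _ gG)).
have [t1 t1T] := fset0Pn _ T0.
have W0 : 0 < \sum_t w t.
  rewrite (bigD1 [` t1T]%fset)//= ltr_wpDr// sumr_ge0// => t _; exact: ltW.
have V0 : (0 < #|V|)%N.
  rewrite lt0n; apply/eqP => /card0_eq V0.
  move: delta0; rewrite -(Td [` t1T]%fset) /tile_size big1// => v.
  by have := V0 v; rewrite inE.
have delta_neq0 : delta%:R != 0 :> R by rewrite pnatr_eq0 -lt0n.
have uniE x : \sum_t w t * x ^+ delta = 1 ->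
    incidence (fun t => w t * x ^+ delta) = @uniform_mult R V delta.
  move=> x1; apply/funext => v.
  have sumD := sum_incidence (fun t => w t * x ^+ delta) Td.
  rewrite /uniform_mult; rewrite x1 mulr1 in sumD; rewrite -sumD.
  under [in RHS]eq_bigr => u _.
    rewrite (_ : incidence _ u =
      incidence (fun t => w t * x ^+ delta) v); first over.
    have incM u' : incidence (fun t => w t * x ^+ delta) u' =
        incidence w u' * x ^+ delta.
      by rewrite /incidence mulr_suml; apply: eq_bigr => t _; ring.
    by rewrite !incM (constD u v).
  by rewrite sumr_const -[X in _ = X / _]mulr_natr mulfK// pnatr_eq0 -lt0n.
(* The witness is the power [- 1 / delta] of the total weight. *)
pose x0 := expR (- (ln (\sum_t w t) / delta%:R)).
have x01 : \sum_t w t * x0 ^+ delta = 1.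
  rewrite -mulr_suml /x0 -expRM_natl mulrN mulrCA divff// mulr1 expRN lnK ?posrE//.
  by rewrite divff// gt_eqF.
have exp0 (x : R) : (fun _ : V => x) = (fun v => x * expR ((fun=> 0) v)).
  by apply/funext => v; rewrite expR0 mulr1.
have q0 x (t : T) : w t * x ^+ delta * expR (incidence_adj (fun=> 0 : R) t) =
    w t * x ^+ delta.
  rewrite /incidence_adj big1 ?expR0 ?mulr1// => v _; exact: mulr0.
have ex : critical_solution w (@uniform_mult R V delta) (fun=> x0) /\
    tiling_poly w (fun=> x0) = 1.
  rewrite exp0; apply: (critical_solution_exp Td); rewrite ?expR_gt0//.
    by under eq_bigr do rewrite q0.
  by rewrite (_ : (fun t => _) = (fun t => w t * x0 ^+ delta)) ?uniE//;
    apply/funext => t; exact: q0.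
move=> x; have [xc xP] : critical_solution w (@uniform_mult R V delta) (fun=> x) /\
    tiling_poly w (fun=> x) = 1.
  by apply: (@xgetPex _ _ [set x : R | critical_solution w
    (@uniform_mult R V delta) (fun=> x) /\ tiling_poly w (fun=> x) = 1]); exists x0.
have /card_gt0P[v0 _] := V0.
have x_gt0 : 0 < x by have [] := xc v0.
have x1 : \sum_t w t * x ^+ delta = 1.
  by rewrite -xP; apply: eq_bigr => t _; rewrite prodrXr -(Td t).
by split=> //; exact: uniE.
Qed.

(** * Second-order expansion of the growth rate *)

(** Quantitative expansion along [da], the laplacian of [y]: the minimisation is applied with
    weights [c] and z = D^t y, whose energy is the pairing of [da] with [y]. *)
Lemma growth_rate_expansion (R : realType) (V : finType) (T : {fset tile V})
    (delta : nat) (w : T -> R) (x r eps : R) (y : V -> R) :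
  let c t := w t * x ^+ delta in
  let alpha := incidence c in
  let da := tiling_laplacian c y in
  (0 < delta)%N -> T != fset0 -> (forall t, 0 < w t) ->
  (forall t : T, tile_size (val t) = delta) ->
  0 < x -> \sum_t c t = 1 -> 0 < r -> eps <= 1 / 4 ->
  (forall u, `|u| <= r -> `|expR u - 1 - u - u ^+ 2 / 2| <= eps * u ^+ 2) ->
  \sum_v da v = 0 ->
  16 * (\sum_t (c t)^-1) * (\sum_v da v * y v) < r ^+ 2 ->
  `|growth_rate w (fun v => alpha v + da v) - growth_rate w alpha
    - (- (1 / 2) * \sum_v da v * y v)| <= 16 * eps * \sum_v da v * y v.
Proof.
move=> c alpha da delta0 T0 w0 Td x0 c1 r0 eps4 expeps da0.
have c0 t : 0 < c t by rewrite mulr_gt0// exprn_gt0.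
pose z : T -> R := incidence_adj y.
have zE : \sum_v da v * y v = \sum_t c t * z t ^+ 2.
  rewrite /da /tiling_laplacian incidence_adjE.
  by apply: eq_bigr => t _; rewrite -mulrA -expr2.
rewrite zE => Zr.
have [Q HQ] := @range_incidence_adjP R V T.
have zQ : forall t, \sum_j z j * Q j t = z t by apply/HQ; exists y.
have [s [/HQ[h _ hs] stat est]] := perturbed_exp_min c0 r0 eps4 expeps zQ Zr.
(* Stationarity in the direction D^t of the indicator of [v] is the critical equation at [v]. *)
have statE v : incidence (fun t => c t * expR (s t)) v = alpha v + da v.
  pose dv : T -> R := incidence_adj (fun u => (u == v)%:R).
  have dvE t : dv t = (val t v)%:R.
    rewrite /dv /incidence_adj (bigD1 v)//= eqxx mulr1 big1 ?addr0// => u uv.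
    by rewrite (negbTE uv) mulr0.
  have : \sum_t c t * (expR (s t) - 1 - z t) * dv t = 0.
    by apply: stat; apply/HQ; exists (fun u => (u == v)%:R).
  rewrite /alpha /da /tiling_laplacian /incidence -big_split/= => st0.
  apply/eqP; rewrite -subr_eq0 -sumrB -[X in _ == X]st0; apply/eqP.
  by apply: eq_bigr => t _; rewrite dvE -/(z t); ring.
have deltaR : delta%:R != 0 :> R by rewrite pnatr_eq0 -lt0n.
(* Summing the critical equations over the vertices gives the normalisation, since [da] has zero sum
   and [delta] is nonzero. *)
have q1 : \sum_t c t * expR (s t) = 1.
  apply: (mulfI deltaR); rewrite -(sum_incidence _ Td).
  under eq_bigr do rewrite statE.
  by rewrite big_split/= da0 addr0 (sum_incidence _ Td) c1.
have gb : growth_rate w (fun v => alpha v + da v) =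
    - (delta%:R * ln x) - \sum_v (alpha v + da v) * h v.
  by apply: (growth_rate_exp T0 w0 Td x0); rewrite ?hs//; apply/funext.
have ga : growth_rate w alpha = - (delta%:R * ln x).
  have a0 (t : T) : incidence_adj (fun=> 0 : R) t = 0.
    by rewrite /incidence_adj big1// => v _; exact: mulr0.
  have -> := @growth_rate_exp R V T delta w alpha (fun=> 0) x T0 w0 Td x0.
  - by rewrite big1 ?subr0// => v _; exact: mulr0.
  - by rewrite -[RHS]c1; apply: eq_bigr => t _; rewrite a0 expR0 mulr1.
  - by congr incidence; apply/funext => t; rewrite a0 expR0 mulr1.
have bh : \sum_v (alpha v + da v) * h v = \sum_t (c t + c t * z t) * s t.
  rewrite -hs -incidence_adjE; apply: eq_bigr => v _; congr (_ * _).
  rewrite /alpha /da /tiling_laplacian /incidence -big_split/=.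
  by apply: eq_bigr => t _; rewrite mulrDr.
have diff : growth_rate w (fun v => alpha v + da v) - growth_rate w alpha =
    \sum_t c t * (expR (s t) - 1 - s t - z t * s t).
  (* The inserted sum of [c t * expR (s t) - c t] vanishes, both weights having mass 1. *)
  have <- : \sum_t (c t * expR (s t) - c t) - \sum_t (c t + c t * z t) * s t =
      \sum_t c t * (expR (s t) - 1 - s t - z t * s t).
    by rewrite -sumrB; apply: eq_bigr => t _; ring.
  by rewrite sumrB q1 c1 gb ga bh; ring.
by rewrite diff mulNr opprK.
Qed.

Theorem theorem5p2 (R : realType) (V : finType) (e : rel V)
    (T : {fset tile V}) (delta : nat) (w : T -> R) (G : {group {perm V}})
    (e_simple : simple_graph e)
    (e_regular : regular_graph e)
    (T_nonempty : T != fset0)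
    (T_size : forall t : T, tile_size (val t) = delta)
    (T_mult : forall (t : T) (v : V), (val t v <= 1)%N)
    (w_gt0 : forall t : T, 0 < w t)
    (G_aut : forall g : {perm V}, g \in G -> graph_automorphism e g)
    (G_inv : forall g : {perm V}, g \in G -> invariant_tiles w g)
    (G_trans : [transitive G, on [set: V]%SET | 'P]) :
  let alpha : V -> R := @uniform_mult R V delta in
  forall eps : R, 0 < eps ->
  exists2 eta : R, 0 < eta &
  forall da : V -> R,
    range (@incidence R V T) da ->
    \sum_(v : V) da v = 0 ->
    Num.sqrt (\sum_(v : V) da v ^+ 2) < eta ->
    `| growth_rate w (fun v => alpha v + da v) - growth_rate w alpha
       - (- (1 / 2) * \sum_(v : V)
            da v * tiling_laplacian_inv (critical_weight w delta) da v) |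
    <= eps * Num.sqrt (\sum_(v : V) da v ^+ 2) ^+ 2.
Proof.
move=> alpha eps eps0.
(* If [delta] is 0, all tiles are empty, so D = 0 and [da] = 0. *)
have [delta0|delta0] := posnP delta.
  exists 1 => // da [f _ fda] _ _.
  have {fda}-> : da = fun=> 0.
    rewrite -fda; apply/funext => v; apply: big1 => t _.
    have /eqP : tile_size (val t) = 0%N by rewrite T_size.
    rewrite /tile_size sum_nat_eq0 => /forallP/(_ v)/= /eqP ->.
    by rewrite mul0r.
  rewrite [X in growth_rate w X - _](_ : _ = alpha); last first.
    by apply/funext => v; exact: addr0.
  rewrite big1 => [|v _]; last exact: mul0r.
  by rewrite subrr mulr0 subr0 normr0 mulr_ge0 ?sqr_ge0// ltW.
have [x0 c1 alphaE] :=
  uniform_solution_spec delta0 T_nonempty w_gt0 T_size G_inv G_trans.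
set c := critical_weight w delta; set x := uniform_solution w delta in x0 c1 alphaE.
have c0 t : 0 < c t by rewrite mulr_gt0// exprn_gt0.
have [L L0 HL] := tiling_laplacian_invP c0.
(* The value 1/4 is the limit allowed by the minimisation; the other bound turns the error
   [16 * eps' * L] into at most [eps]. *)
pose eps' := Num.min (1 / 4) (eps / (16 * (L + 1))).
have L1 : 0 < L + 1 by rewrite ltr_wpDl.
have eps'0 : 0 < eps'.
  by rewrite lt_min; apply/andP; split; [lra|rewrite divr_gt0// mulr_gt0].
have eps'L : 16 * eps' * (L + 1) <= eps.
  rewrite mulrAC -ler_pdivlMl ?mulr_gt0// mulrC.
  by rewrite /eps' ge_min lexx orbT.
(* With this radius the cubic remainder, at most [expR 1 * |u| * u ^+ 2], is below
   [eps' * u ^+ 2]. *)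
pose r := Num.min 1 (eps' / expR 1).
have r0 : 0 < r by rewrite lt_min ltr01 divr_gt0// expR_gt0.
have expeps (u : R) : `|u| <= r -> `|expR u - 1 - u - u ^+ 2 / 2| <= eps' * u ^+ 2.
  rewrite le_min => /andP[u1 ue]; apply: le_trans (expR_remainder2 u1) _.
  by rewrite ler_wpM2r ?sqr_ge0// mulrC -ler_pdivlMr ?expR_gt0.
set J := \sum_t (c t)^-1.
have J0 : 0 <= J by apply: sumr_ge0 => t _; rewrite invr_ge0 ltW.
pose K := 16 * J * L.
have K0 : 0 <= K by rewrite !mulr_ge0.
have K1 : 0 < K + 1 by rewrite ltr_wpDl.
(* The pairing of [da] with [y] is at most [L * S], so [K * S < r ^+ 2] gives the required
   smallness; it follows from this radius as [K <= (K + 1) ^+ 2]. *)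
exists (r / (K + 1)); first by rewrite divr_gt0.
move=> da daD da0 da_small; have [yD yE yL] := HL da daD.
set y := tiling_laplacian_inv c da in yD yE yL *.
set S := \sum_v da v ^+ 2 in da_small yL *.
have S0 : 0 <= S by apply: sumr_ge0 => v _; exact: sqr_ge0.
have SE : Num.sqrt S ^+ 2 = S by rewrite sqr_sqrtr.
have Sr : K * S < r ^+ 2.
  move: da_small; rewrite ltr_pdivlMr// => da_small.
  have : (Num.sqrt S * (K + 1)) ^+ 2 < r ^+ 2.
    by rewrite ltr_sqr ?nnegrE ?mulr_ge0 ?sqrtr_ge0 ?ltW.
  rewrite exprMn SE; apply: le_lt_trans.
  have := mulr_ge0 S0 K0; have := mulr_ge0 S0 (sqr_ge0 K); nra.
rewrite SE /alpha -alphaE.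
have := @growth_rate_expansion R V T delta w x r eps' y delta0 T_nonempty w_gt0
  T_size x0 c1 r0 _ expeps.
rewrite -/c -[tiling_laplacian _ y]/(tiling_laplacian c y) yE => H.
apply: le_trans (H _ da0 _) _.
- by rewrite ge_min lexx.
- rewrite -/J; apply: le_lt_trans Sr; rewrite -/K /K -[leRHS]mulrA.
  by rewrite ler_wpM2l// mulr_ge0.
- apply: (@le_trans _ _ (16 * eps' * (L + 1) * S)); last by rewrite ler_wpM2r.
  rewrite -!mulrA ler_wpM2l// (ler_wpM2l (ltW eps'0))//.
  by apply: le_trans yL _; rewrite ler_wpM2r// lerDl.
Qed.
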